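(* Let $d\ge2$. For any nonempty compact set $A\subset\mathbb{R}^d$, $$\overline{\dim}^{\mathrm{out}}_B A=\overline{\dim}^{\mathrm{out}}_M A\qquad\text{and}\qquad \underline{\dim}^{\mathrm{out}}_B A\le\underline{\dim}^{\mathrm{out}}_M A .$$
   Context: Notation: $V$ is Lebesgue measure on $\mathbb{R}^d$, $\mathbb{S}^{d-1}$ the unit sphere, $A_\varepsilon=\{x\in\mathbb{R}^d:\mathrm{dist}(x,A)\le\varepsilon\}$. For a nonempty closed set $A\subset\mathbb{R}^d$, $\mathrm{Unp}(A)$ is the set of $y\in\mathbb{R}^d\setminus A$ having a unique nearest point $\pi_A(y)$ in $A$. The generalized normal bundle is $N(A)=\{(\pi_A(y),\frac{y-\pi_A(y)}{\mathrm{dist}(y,A)}):y\in \mathrm{Unp}(A)\}$. The local reach of $A$ at $(x,u)\in N(A)$ is $\delta(A,x,u)=\sup\{t\ge 0:\pi_A(x+tu)=x\}\in(0,\infty]$, and $\delta(A,x,u):=0$ for $(x,u)\in(\mathbb{R}^d\times\mathbb{S}^{d-1})\setminus N(A)$. Outer box dimension: for $A$ compact and $t>0$ let $M_t(A)=\{x\in\partial A:\exists u\in\mathbb{S}^{d-1}\text{ with }t<\delta(A,x,u)\}$ and let $\Theta_t(A)$ be the minimal number of open sets of diameter at most $t$ needed to cover $M_t(A)$. Then $\overline{\dim}^{\mathrm{out}}_B A=\limsup_{t\to0^+}\frac{\log\Theta_t(A)}{-\log t}$ and $\underline{\dim}^{\mathrm{out}}_B A=\liminf_{t\to0^+}\frac{\log\Theta_t(A)}{-\log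 t}$. Outer Minkowski dimension: for $q\ge0$, $\overline{\mathcal M}^{\mathrm{out},q}(A)=\limsup_{\varepsilon\to0^+}\varepsilon^{q-d}V(A_\varepsilon\setminus A)$, $\underline{\mathcal M}^{\mathrm{out},q}(A)$ is the corresponding $\liminf$; $\overline{\dim}^{\mathrm{out}}_M A=\inf\{q\ge0:\overline{\mathcal M}^{\mathrm{out},q}(A)=0\}$ and $\underline{\dim}^{\mathrm{out}}_M A=\inf\{q\ge0:\underline{\mathcal M}^{\mathrm{out},q}(A)=0\}$. *)

(* Defs.v *)
From HB Require Import structures.
From mathcomp Require Import all_boot all_order all_algebra.
From mathcomp Require Import all_classical all_reals all_analysis.

Set Implicit Arguments.
Unset Strict Implicit.
Unset Printing Implicit Defensive.

Import Order.TTheory GRing.Theory Num.Theory.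
Import numFieldNormedType.Exports.

Local Open Scope classical_set_scope.
Local Open Scope ring_scope.

(* R^d is 'rV[R]_d.  The library's norm `|x| on row vectors is the sup norm
   (it induces the usual topology), so the Euclidean norm is defined here. *)
Definition enorm (R : realType) (d : nat) (x : 'rV[R]_d) : R :=
  Num.sqrt (\sum_(i < d) x ord0 i ^+ 2).

Definition sphere (R : realType) (d : nat) : set 'rV[R]_d :=
  [set u | enorm u = 1].

Definition ediam (R : realType) (d : nat) (U : set 'rV[R]_d) : \bar R :=
  ereal_sup [set (enorm (xy.1 - xy.2))%:E | xy in U `*` U].

Definition boundary (T : topologicalType) (A : set T) : set T :=
  closure A `\` interior A.

(* Lebesgue measure on R^d: the d-fold product of the one-dimensional Lebesgue
   measure, built with the library's binary product measure on the iterated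
   product R * (R * ( ... * unit)) and transported to row vectors along the
   coordinate bijection [row_of_iter].  As for the library's product measure,
   its value is meaningful on Borel sets. *)
Fixpoint iterR (R : realType) (n : nat) : {disp & measurableType disp} :=
  match n with
  | 0 => existT (fun disp => measurableType disp) _ (unit : measurableType _)
  | m.+1 => existT (fun disp => measurableType disp) _
      ((measurableTypeR R * projT2 (iterR R m))%type : measurableType _)
  end.

Fixpoint iter_lebesgue (R : realType) (n : nat) :
    set (projT2 (iterR R n)) -> \bar R :=
  match n with
  | 0 => \d_(tt : unit)
  | m.+1 => (@lebesgue_measure R \x @iter_lebesgue R m)%E
  end.

Lemma product_sigma_finite d1 d2 (T1 : measurableType d1)
    (T2 : measurableType d2) (R : realType)
    (m1 : {sigma_finite_measure set T1 -> \bar R})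
    (m2 : {sigma_finite_measure set T2 -> \bar R}) :
  sigma_finite setT (m1 \x m2)%E.
Proof.
have /sigma_finiteP[F [TF ndF Foo]] := sigma_finiteT m1.
have /sigma_finiteP[G [TG ndG Goo]] := sigma_finiteT m2.
exists (fun n => F n `*` G n).
  rewrite -setXTT TF TG predeqE => -[x y]; split.
    move=> [/= [n _ Fnx] [k _ Gky]]; exists (maxn n k) => //; split.
    - by move: x Fnx; exact/subsetPset/ndF/leq_maxl.
    - by move: y Gky; exact/subsetPset/ndG/leq_maxr.
  by move=> [n _ []/= ? ?]; split; exists n.
move=> k; have [? ?] := Foo k; have [? ?] := Goo k.
split; first exact: measurableX.
by rewrite product_measure1E// lte_mul_pinfty// ge0_fin_numE.
Qed.

Lemma iter_lebesgue_measure (R : realType) (n : nat) :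
  exists mu : {sigma_finite_measure set (projT2 (iterR R n)) -> \bar R},
    @iter_lebesgue R n = mu.
Proof.
elim: n => [|n [mu IH]] /=.
  by exists (@dirac _ unit tt R : {finite_measure set unit -> \bar R}).
rewrite IH.
pose nu : {measure set (measurableTypeR R * projT2 (iterR R n))%type -> \bar R}
  := (@lebesgue_measure R \x mu)%E.
pose sf := @Measure_isSigmaFinite.Build _ _ _ nu
  (product_sigma_finite (@lebesgue_measure R) mu).
pose nuS : {sigma_finite_measure
    set (measurableTypeR R * projT2 (iterR R n))%type -> \bar R}
  := HB.pack (nu : set _ -> \bar R) (Measure.on nu) sf.
by exists nuS.
Qed.

Fixpoint row_of_iter (R : realType) (n : nat) :
    projT2 (iterR R n) -> 'rV[R]_n :=
  match n with
  | 0 => fun=> 0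
  | m.+1 => fun p => row_mx (p.1)%:M (row_of_iter p.2) : 'rV[R]_(1 + m)
  end.

Definition lebesgue_rV (R : realType) (d : nat) (S : set 'rV[R]_d) : \bar R :=
  iter_lebesgue (@row_of_iter R d @^-1` S).

Lemma row_of_iter_box (R : realType) (n : nat) (B : 'I_n.+1 -> set R) :
  @row_of_iter R n.+1 @^-1` [set x | forall i, B i (x ord0 i)] =
  B ord0 `*` (@row_of_iter R n @^-1`
    [set x | forall i, B (lift ord0 i) (x ord0 i)]).
Proof.
have row0 p : (@row_of_iter R n.+1 p) ord0 ord0 = p.1.
  rewrite /=.
  have -> : ord0 = lshift n ord0 :> 'I_(1 + n) by exact/val_inj.
  by rewrite (row_mxEl (p.1)%:M) mxE eqxx mulr1n.
have rowS p i : (@row_of_iter R n.+1 p) ord0 (lift ord0 i)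
              = row_of_iter p.2 ord0 i.
  rewrite /=.
  have -> : lift ord0 i = rshift 1 i :> 'I_(1 + n) by exact/val_inj.
  by rewrite (row_mxEr (p.1)%:M).
apply/seteqP; split => [p H|p [H1 H2] i].
  split; first by have := H ord0; rewrite row0.
  by move=> i; have := H (lift ord0 i); rewrite rowS.
case: (unliftP ord0 i) => [j ->|->]; first by rewrite rowS; exact: H2.
by rewrite row0.
Qed.

Lemma lebesgue_rV_box (R : realType) (n : nat) (B : 'I_n -> set R) :
  (forall i, measurable (B i)) ->
  measurable (@row_of_iter R n @^-1` [set x | forall i, B i (x ord0 i)]) /\
  lebesgue_rV [set x : 'rV[R]_n | forall i, B i (x ord0 i)] =
  (\prod_(i < n) lebesgue_measure (B i : set (measurableTypeR R)))%E.
Proof.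
elim: n B => [|n IH] B mB.
  have E : [set x : 'rV[R]_0 | forall i, B i (x ord0 i)] = setT.
    by apply/seteqP; split => // x _ [].
  rewrite /lebesgue_rV E preimage_setT big_ord0; split.
    exact: (@measurableT _ (unit : measurableType _)).
  by rewrite /= diracT.
have [mB' eB'] := IH (fun i => B (lift ord0 i)) (fun i => mB _).
rewrite /lebesgue_rV row_of_iter_box; split; first exact: (measurableX (mB ord0) mB').
rewrite big_ord_recl -eB' /lebesgue_rV /=.
have [mu ->] := iter_lebesgue_measure R n.
exact: (@product_measure1E _ _ (measurableTypeR R) _ R lebesgue_measure mu _ _
  (mB ord0) mB').
Qed.

Section outer_dimensions.
Variables (R : realType) (d : nat).
Implicit Types (A : set 'rV[R]_d) (x y u : 'rV[R]_d) (t q : R).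

Definition dist y A : R := inf [set enorm (y - a) | a in A].

Definition parallel_set A t : set 'rV[R]_d := [set x | dist x A <= t].

Definition nearest A y : set 'rV[R]_d :=
  [set x | A x /\ enorm (y - x) = dist y A].

(* [is_proj A y x] reads pi_A(y) = x; for y in A it holds exactly when x = y. *)
Definition is_proj A y x : Prop := unique (nearest A y) x.

Definition Unp A : set 'rV[R]_d := [set y | ~ A y /\ exists x, is_proj A y x].

Definition normal_bundle A : set ('rV[R]_d * 'rV[R]_d) :=
  [set xu | exists y, [/\ Unp A y, is_proj A y xu.1 &
                          xu.2 = (dist y A)^-1 *: (y - xu.1)]].

Definition local_reach A x u : \bar R :=
  if `[< normal_bundle A (x, u) >] then
    ereal_sup [set t%:E | t in [set t | 0 <= t /\ is_proj A (x + t *: u) x]]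
  else 0%E.

Definition reach_set A t : set 'rV[R]_d :=
  [set x | boundary A x /\
           exists u, sphere u /\ (t%:E < local_reach A x u)%E].

Definition covering_number A t : \bar R :=
  ereal_inf [set n%:R%:E | n in [set n : nat |
    exists U : 'I_n -> set 'rV[R]_d,
      (forall i, open (U i) /\ (ediam (U i) <= t%:E)%E) /\
      reach_set A t `<=` \bigcup_i U i]].

Definition box_quotient A t : \bar R :=
  (lne (covering_number A t) / (- ln t)%:E)%E.

Definition upper_out_box_dim A : \bar R := limf_esup (box_quotient A) 0^'+.

Definition lower_out_box_dim A : \bar R := limf_einf (box_quotient A) 0^'+.

Definition out_minkowski_quotient A q (e : R) : \bar R :=
  ((e `^ (q - d%:R))%:E * lebesgue_rV (parallel_set A e `\` A))%E.

Definition upper_out_minkowski_content A q : \bar R :=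
  limf_esup (out_minkowski_quotient A q) 0^'+.

Definition lower_out_minkowski_content A q : \bar R :=
  limf_einf (out_minkowski_quotient A q) 0^'+.

Definition upper_out_minkowski_dim A : \bar R :=
  ereal_inf [set q%:E | q in
    [set q | 0 <= q /\ upper_out_minkowski_content A q = 0%E]].

Definition lower_out_minkowski_dim A : \bar R :=
  ereal_inf [set q%:E | q in
    [set q | 0 <= q /\ lower_out_minkowski_content A q = 0%E]].

End outer_dimensions.

(* Main.v *)
(* Along a segment from a nearest point [x] of [y] towards [y] the nearest point
   is [x] and is unique, so every [y] outside [A] with [dist y A > t] projects
   into [reach_set A t].  Hence the shell [t < dist y A <= 2 t] lies in the union
   of [covering_number A t] cubes of side [6 t], and summing over dyadic shells
   bounds the volume of [parallel_set A e `\` A] by a geometric series.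
   Conversely each [x] in [reach_set A t] touches a ball of radius [t] avoiding
   [A]; shrinking these balls at the points of a maximal separated family gives
   disjoint cubes in [parallel_set A t `\` A], so the volume of this set is at
   least [(c t)^d * covering_number A t] for a constant [c] depending only on
   [d]. *)
Require Import Defs.
From mathcomp Require Import all_boot all_order all_algebra.
From mathcomp Require Import all_classical all_reals all_analysis.
From mathcomp Require Import ring lra.

Set Implicit Arguments.
Unset Strict Implicit.
Unset Printing Implicit Defensive.

Import Order.TTheory GRing.Theory Num.Theory.
Import numFieldNormedType.Exports.
Local Open Scope classical_set_scope.
Local Open Scope ring_scope.

(** * Euclidean norm and its comparison with the sup norm *)

Section euclidean.
Context {R : realType} {d : nat}.
Implicit Types (x y z u v a : 'rV[R]_d) (t s : R) (A : set 'rV[R]_d).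

Definition dotv x y : R := \sum_(i < d) x ord0 i * y ord0 i.

Lemma dotvDl x y z : dotv (x + y) z = dotv x z + dotv y z.
Proof. by rewrite -big_split; apply: eq_bigr => i _; rewrite mxE mulrDl. Qed.

Lemma dotvC x y : dotv x y = dotv y x.
Proof. by apply: eq_bigr => i _; rewrite mulrC. Qed.

Lemma dotvZl t x y : dotv (t *: x) y = t * dotv x y.
Proof. by rewrite mulr_sumr; apply: eq_bigr => i _; rewrite mxE mulrA. Qed.

Lemma dotvDr x y z : dotv z (x + y) = dotv z x + dotv z y.
Proof. by rewrite dotvC dotvDl !(dotvC z). Qed.

Lemma dotvZr t x y : dotv x (t *: y) = t * dotv x y.
Proof. by rewrite dotvC dotvZl (dotvC x). Qed.

Lemma dotvNl x y : dotv (- x) y = - dotv x y.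
Proof. by rewrite -scaleN1r dotvZl mulN1r. Qed.

Lemma dotvNr x y : dotv y (- x) = - dotv y x.
Proof. by rewrite dotvC dotvNl dotvC. Qed.

Lemma dotvv_ge0 x : 0 <= dotv x x.
Proof. by apply: sumr_ge0 => i _; rewrite -expr2 sqr_ge0. Qed.

Lemma enormE x : enorm x = Num.sqrt (dotv x x).
Proof. by congr Num.sqrt; apply: eq_bigr => i _; rewrite expr2. Qed.

Lemma sqr_enorm x : enorm x ^+ 2 = dotv x x.
Proof. by rewrite enormE sqr_sqrtr// dotvv_ge0. Qed.

Lemma enorm_ge0 x : 0 <= enorm x.
Proof. exact: sqrtr_ge0. Qed.

Lemma enorm_coord x i : `|x ord0 i| <= enorm x.
Proof.
rewrite -sqrtr_sqr ler_wsqrtr// (bigD1 i)//= lerDl.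
by apply: sumr_ge0 => j _; exact: sqr_ge0.
Qed.

Lemma enorm_eq0 x : (enorm x == 0) = (x == 0).
Proof.
apply/eqP/eqP => [x0|->].
  apply/rowP => i; apply/eqP; rewrite mxE -normr_le0 -x0; exact: enorm_coord.
by rewrite /enorm big1 ?sqrtr0// => i _; rewrite mxE expr0n.
Qed.

Lemma enorm0 : enorm (0 : 'rV[R]_d) = 0.
Proof. by apply/eqP; rewrite enorm_eq0. Qed.

Lemma enorm_gt0 x : (0 < enorm x) = (x != 0).
Proof. by rewrite lt_def enorm_eq0 enorm_ge0 andbT. Qed.

Lemma enormZ t x : enorm (t *: x) = `|t| * enorm x.
Proof.
by rewrite !enormE dotvZl dotvZr mulrA -expr2 sqrtrM ?sqr_ge0// sqrtr_sqr.
Qed.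

Lemma enormN x : enorm (- x) = enorm x.
Proof. by rewrite -scaleN1r enormZ normrN1 mul1r. Qed.

Lemma enormBC x y : enorm (x - y) = enorm (y - x).
Proof. by rewrite -enormN opprB. Qed.

(** Cauchy-Schwarz: the squared norm of [enorm y *: x - enorm x *: y] is nonnegative and equals
    [2 a b (a b - dotv x y)] with [a = enorm x], [b = enorm y]. *)
Lemma dotv_le_enorm x y : dotv x y <= enorm x * enorm y.
Proof.
have [->|x0] := eqVneq x 0.
  by rewrite enorm0 mul0r /dotv big1// => i _; rewrite mxE mul0r.
have [->|y0] := eqVneq y 0.
  by rewrite enorm0 mulr0 /dotv big1// => i _; rewrite mxE mulr0.
have := dotvv_ge0 (enorm y *: x - enorm x *: y).
rewrite !(dotvDl, dotvDr, dotvNl, dotvNr, dotvZl, dotvZr) -!sqr_enorm (dotvC y x).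
move: x0 y0; rewrite -!enorm_gt0.
move: (enorm x) (enorm y) (dotv x y) => a b c a0 b0 h.
have ab : 0 < a * b by exact: mulr_gt0.
rewrite -(ler_pM2l ab); nra.
Qed.

Lemma ler_enormD x y : enorm (x + y) <= enorm x + enorm y.
Proof.
rewrite -(ler_pXn2r (n := 2)) ?nnegrE ?addr_ge0 ?enorm_ge0//.
rewrite sqrrD !sqr_enorm dotvDl !dotvDr (dotvC y x).
have := dotv_le_enorm x y; lra.
Qed.

Lemma ler_enormB x y z : enorm (x - z) <= enorm (x - y) + enorm (y - z).
Proof. by apply: le_trans (ler_enormD _ _); rewrite addrA subrK. Qed.

Lemma normr_le_enorm x : `|x| <= enorm x.
Proof.
rewrite [leLHS]/Num.norm/= mx_normrE; apply/bigmax_leP; split=> [|[i j] _].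
  exact: enorm_ge0.
by rewrite (ord1 i) /=; exact: enorm_coord.
Qed.

Lemma coord_le_norm x i : `|x ord0 i| <= `|x|.
Proof.
rewrite [leRHS]/Num.norm/= mx_normrE.
by apply/bigmax_geP; right; exists (ord0, i).
Qed.

(** The factor [d], cruder than its square root, avoids radicals; later estimates only ask for a
    constant depending on [d]. *)
Lemma enorm_le_bound x (c : R) : 0 <= c -> (forall i, `|x ord0 i| <= c) ->
  enorm x <= d%:R * c.
Proof.
move=> c0 xc.
have dc0 : 0 <= d%:R * c by rewrite mulr_ge0.
rewrite -(ler_pXn2r (n := 2)) ?nnegrE ?enorm_ge0// sqr_enorm.
have : dotv x x <= \sum_(i < d) c ^+ 2.
  apply: ler_sum => i _; rewrite -expr2 -real_normK ?num_real//.
  by rewrite lerXn2r ?nnegrE.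
move=> /le_trans; apply.
rewrite sumr_const card_ord -[leLHS]mulr_natl exprMn ler_wpM2r ?sqr_ge0//.
by rewrite -natrX ler_nat -mulnn; case: (d) => // n; exact: leq_pmull.
Qed.

Lemma enorm_le_norm x : enorm x <= d%:R * `|x|.
Proof. by apply: enorm_le_bound => // i; exact: coord_le_norm. Qed.

(** Swapping [x] and [y] makes the one-sided bound two-sided; the topology is that of the sup norm,
    which costs a factor [d]. *)
Lemma enorm_lipschitz_continuous (f : 'rV[R]_d -> R) :
  (forall x y, f x <= f y + enorm (x - y)) -> continuous f.
Proof.
move=> fl x; apply/(@cvgrPdist_lt _ _ _ (nbhs x) (nbhs_filter x)) => e e0.
(* Dividing by [d + 1] rather than [d] also covers [d = 0]. *)
have d0 : 0 < d%:R + 1 :> R by rewrite ltr_wpDl.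
near=> y.
have fxy : `|f x - f y| <= enorm (x - y).
  rewrite ler_norml; have := fl x y; have := fl y x; rewrite (enormBC y x); lra.
apply: le_lt_trans fxy _; apply: le_lt_trans (enorm_le_norm _) _.
have : `|x - y| < e / (d%:R + 1).
  have : ball x (e / (d%:R + 1)) y by near: y; apply: nbhsx_ballx; exact: divr_gt0.
  by rewrite -ball_normE.
rewrite ltr_pdivlMr// => h.
have := normr_ge0 (x - y); nra.
Unshelve. all: by end_near. Qed.

(** * Distance function, nearest points and local reach *)

Lemma dist_le A y a : A a -> dist y A <= enorm (y - a).
Proof.
move=> Aa; apply: ge_inf; last by exists a.
by exists 0 => _ [b _ <-]; exact: enorm_ge0.
Qed.

Lemma le_dist A y t : A !=set0 -> (forall a, A a -> t <= enorm (y - a)) ->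
  t <= dist y A.
Proof.
move=> [a Aa] tA; apply: lb_le_inf; first by exists (enorm (y - a)), a.
by move=> _ [b Ab <-]; exact: tA.
Qed.

Lemma dist_lipschitz A x y : dist x A <= dist y A + enorm (x - y).
Proof.
have [->|/set0P A0] := eqVneq A set0.
  (* The infimum of the empty set has the default value 0. *)
  by rewrite /dist !image_set0 inf0 add0r enorm_ge0.
rewrite -lerBlDr; apply: le_dist => // a Aa.
rewrite lerBlDr [leRHS]addrC; apply: le_trans (dist_le x Aa) _.
exact: ler_enormB.
Qed.

Lemma dist_continuous A : continuous (fun y => dist y A).
Proof. by apply: enorm_lipschitz_continuous => x y; exact: dist_lipschitz. Qed.

Lemma nearest_exists A y : A !=set0 -> compact A -> exists x, nearest A y x.
Proof.
move=> A0 cA.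
have cf : {within A, continuous (fun a => enorm (y - a))}.
  apply: continuous_subspaceT; apply: enorm_lipschitz_continuous => x z.
  by rewrite (enormBC x z) ler_enormB.
have [x xA xmin] := compact_EVT_min A0 cA cf.
exists x; split; first by rewrite inE in xA.
apply/eqP; rewrite eq_le dist_le ?andbT; last by rewrite inE in xA.
by apply: le_dist => // a Aa; apply: xmin; rewrite inE.
Qed.

Lemma dist_gt0 A y : A !=set0 -> compact A -> ~ A y -> 0 < dist y A.
Proof.
move=> A0 cA nAy; have [x [Ax <-]] := nearest_exists y A0 cA.
by rewrite enorm_gt0 subr_eq0; apply: contra_notN nAy => /eqP ->.
Qed.

Lemma parallel_set_closed A t : closed (parallel_set A t).
Proof.
rewrite (_ : parallel_set A t = (fun y => dist y A) @^-1` [set r | r <= t])//.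
apply: closed_comp => [x _|]; first exact: dist_continuous.
exact: closed_le.
Qed.

(** The upper bound on [t] is strict: at [t = dist y A] the point is [y], which may have several
    nearest points. *)
Lemma nearest_segment A y x t : nearest A y x -> 0 < dist y A ->
  0 <= t < dist y A ->
  is_proj A (x + t *: ((dist y A)^-1 *: (y - x))) x /\
  dist (x + t *: ((dist y A)^-1 *: (y - x))) A = t.
Proof.
move=> [Ax yx]; set r := dist y A => r0 /andP[t0 tr].
set u := r^-1 *: (y - x); set p := x + t *: u.
have uu : dotv u u = 1.
  rewrite -sqr_enorm enormZ yx ger0_norm ?invr_ge0 ?(ltW r0)//.
  by rewrite mulVf ?gt_eqF// expr1n.
have px : enorm (p - x) = t.
  by rewrite /p addrC addKr enormZ enormE uu sqrtr1 mulr1 ger0_norm.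
have yE : y = x + r *: u by rewrite scalerA divff ?gt_eqF// scale1r addrC subrK.
clearbody u.
(* [|a - p|^2 - t^2] is the convex combination of [|a - x|^2] and
   [|a - y|^2 - r^2 >= 0] with weights [1 - t/r] and [t/r] *)
have strict a : A a -> a != x -> t < enorm (p - a).
  move=> Aa ax; have ra : r <= enorm (y - a) by exact: dist_le.
  rewrite -(ltr_pXn2r (n := 2)) ?nnegrE ?enorm_ge0// sqr_enorm.
  have pa : dotv (p - a) (p - a) =
      dotv (x - a) (x - a) + 2 * t * dotv (x - a) u + t ^+ 2.
    rewrite /p (addrAC x); move: (x - a) => w.
    rewrite !(dotvDl, dotvDr, dotvZl, dotvZr) uu (dotvC u); ring.
  have ya : dotv (y - a) (y - a) =
      dotv (x - a) (x - a) + 2 * r * dotv (x - a) u + r ^+ 2.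
    rewrite yE (addrAC x); move: (x - a) => w.
    rewrite !(dotvDl, dotvDr, dotvZl, dotvZr) uu (dotvC u); ring.
  have : r ^+ 2 <= dotv (y - a) (y - a).
    by rewrite -sqr_enorm lerXn2r ?nnegrE ?enorm_ge0// ltW.
  have : 0 < dotv (x - a) (x - a).
    by rewrite -sqr_enorm exprn_gt0// enorm_gt0 subr_eq0 eq_sym.
  rewrite pa ya; move: (dotv (x - a) (x - a)) (dotv (x - a) u) => w c w0 h.
  suff : 0 < w + 2 * t * c by lra.
  have h1 : 0 <= w + 2 * r * c by lra.
  (* For [c < 0] the expression [w + 2 * t * c] strictly decreases in [t] and is still nonnegative
     at [r > t]. *)
  have [c0|c0] := leP 0 c; first by have := mulr_ge0 t0 c0; lra.
  have : 0 < (r - t) * - c by rewrite mulr_gt0 ?subr_gt0 ?oppr_gt0.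
  lra.
have dp : dist p A = t.
  apply/eqP; rewrite eq_le -{1}px dist_le//=; apply: le_dist; first by exists x.
  move=> a Aa; have [->|ax] := eqVneq a x; first by rewrite px.
  by rewrite ltW// strict.
split=> //; split; first by split; rewrite // px dp.
move=> a [Aa]; rewrite dp => pa.
by apply/esym; apply: contra_eq pa => ax; rewrite gt_eqF ?strict// eq_sym.
Qed.

Lemma nearest_reach_set A y x t : nearest A y x -> 0 <= t < dist y A ->
  reach_set A t x.
Proof.
move=> nyx /andP[t0 tr]; have [Ax yx] := nyx.
have r0 := le_lt_trans t0 tr.
pose u := (dist y A)^-1 *: (y - x).
have su : sphere u.
  by rewrite /sphere/= enormZ yx ger0_norm ?mulVf ?gt_eqF ?invr_ge0 ?(ltW r0).
have u1 s : 0 <= s -> enorm (s *: u) = s.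
  by move=> s0; rewrite enormZ su mulr1 ger0_norm.
have seg s : 0 <= s < dist y A ->
    is_proj A (x + s *: u) x /\ dist (x + s *: u) A = s.
  exact: nearest_segment.
have notA s : 0 < s < dist y A -> ~ A (x + s *: u).
  move=> /andP[s0 sr] Axs; have [|_] := seg s; first by rewrite (ltW s0).
  move=> E; have := dist_le (x + s *: u) Axs.
  by rewrite E subrr enorm0; rewrite leNgt s0.
split.
  split; first exact: subset_closure.
  (* An interior [x] would put [x + s *: u] in [A] for small [s > 0], against [notA]. *)
  move=> intx; have : \forall s \near 0^'+, A (x + s *: u).
    have : x + s *: u @[s --> 0^'+] --> x + 0 *: u.
      apply: cvg_at_right_filter; apply: cvgD; first exact: cvg_cst.
      by apply: cvgZr_tmp; exact: cvg_id.
    by rewrite scale0r addr0; apply; exact: intx.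
  move=> xA; near (0 : R)^'+ => s.
  have /notA : 0 < s < dist y A.
    by apply/andP; split; near: s; [exact: nbhs_right_gt|exact: nbhs_right_lt].
  by apply; near: s.
exists u; split=> //.
have NBxu : normal_bundle A (x, u).
  (* A midpoint of the segment replaces [y], whose projection may not be unique. *)
  exists (x + (dist y A / 2) *: u).
  have [|P D] := seg (dist y A / 2); first by lra.
  split.
  - by split; [apply: notA; lra|exists x].
  - exact: P.
  - by rewrite D /= addrC addKr scalerA mulVf ?scale1r// gt_eqF//; lra.
rewrite /local_reach; case: asboolP => // _.
(* The reach must exceed [t] strictly, and [seg] stops short of [dist y A]; a value in between does
   both. *)
have [|P _] := seg ((t + dist y A) / 2); first by lra.
apply: (@lt_le_trans _ _ ((t + dist y A) / 2)%:E); first by rewrite lte_fin; lra.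
apply: ereal_sup_ubound; exists ((t + dist y A) / 2) => //; split=> //; lra.
Unshelve. all: by end_near. Qed.

(** A local reach above [t] gives some [s > t] for which the open ball of radius [s] about
    [x + s *: u] misses [A]; it contains the smaller balls tangent to it at [x]. *)
Lemma reach_set_empty_ball A t x : 0 <= t -> reach_set A t x ->
  exists u, [/\ A x, enorm u = 1 &
    forall s a, A a -> 0 <= s <= t -> s <= enorm (x + s *: u - a)].
Proof.
move=> t0 [_ [u [su]]]; rewrite /local_reach; case: asboolP => [|_]; last first.
  (* Off the normal bundle the local reach is 0, which does not exceed [t]. *)
  by rewrite lte_fin ltNge t0.
move=> _ /ereal_sup_gt[_ [s [s0 [[Ax sx] _]] <-]]; rewrite lte_fin => ts.
exists u; split=> // r a Aa /andP[r0 rt].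
have : s <= enorm (x + s *: u - a).
  apply: le_trans (dist_le _ Aa); rewrite -sx addrC addKr enormZ su mulr1.
  exact: ler_norm.
have := ler_enormB (x + s *: u) (x + r *: u) a.
rewrite opprD addrACA subrr add0r -scalerBl enormZ su mulr1 ger0_norm; lra.
Qed.

End euclidean.

(** * Lebesgue measure on row vectors *)

Section lebesgue_row_vectors.
Context {R : realType} {d : nat}.
Implicit Types (S T : set 'rV[R]_d) (x p : 'rV[R]_d) (h : R).

(** Measurability is tested on the iterated product, where [lebesgue_rV] is an actual measure. *)
Definition measurable_rV S := measurable (@row_of_iter R d @^-1` S).

Lemma measurable_rV_box (B : 'I_d -> set R) : (forall i, measurable (B i)) ->
  measurable_rV [set x | forall i, B i (x ord0 i)].
Proof. by move=> mB; have [] := lebesgue_rV_box mB. Qed.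

Lemma measurable_rVD S T : measurable_rV S -> measurable_rV T ->
  measurable_rV (S `\` T).
Proof. by move=> mS mT; exact: measurableD. Qed.

Lemma measurable_rV_bigcup_ord n (F : 'I_n -> set 'rV[R]_d) :
  (forall k, measurable_rV (F k)) -> measurable_rV (\bigcup_k F k).
Proof.
move=> mF; rewrite /measurable_rV preimage_bigcup.
by apply: fin_bigcup_measurable => [|k _]; [exact: finite_finset|exact: mF].
Qed.

(** An open set is the union of the countably many rational boxes it contains; other boxes are
    replaced by the empty set. *)
Lemma open_measurable_rV S : open S -> measurable_rV S.
Proof.
move=> oS.
pose box (q : 'rV[rat]_d * 'rV[rat]_d) : set 'rV[R]_d :=
  [set x | forall i, `]ratr (q.1 ord0 i), ratr (q.2 ord0 i)[%classic (x ord0 i)].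
have -> : S = \bigcup_q if `[< box q `<=` S >] then box q else set0.
  apply/seteqP; split=> [x Sx|x [q _]]; last by case: asboolP => // h /h.
  have [/= e e0 xeS] : \forall e \near 0^'+, ball x e `<=` S.
    by apply: open_subball.
  (* [open_subball] speaks of radii strictly below [e], hence the halving. *)
  have e2 : 0 < e / 2 by rewrite divr_gt0.
  have {}xeS : ball x (e / 2) `<=` S.
    apply: xeS => //=; rewrite sub0r normrN gtr0_norm//; lra.
  have /choice[a aP] (i : 'I_d) : exists a : rat,
      x ord0 i - e / 2 < ratr a < x ord0 i.
    have : x ord0 i - e / 2 < x ord0 i by rewrite gtrBl.
    by move=> /rat_in_itvoo[a]; rewrite in_itv/= => ?; exists a.
  have /choice[b bP] (i : 'I_d) : exists b : rat,
      x ord0 i < ratr b < x ord0 i + e / 2.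
    have : x ord0 i < x ord0 i + e / 2 by rewrite ltrDl.
    by move=> /rat_in_itvoo[b]; rewrite in_itv/= => ?; exists b.
  exists (\row_i a i, \row_i b i) => //=.
  have abx : box (\row_i a i, \row_i b i) x.
    move=> i /=; rewrite in_itv/= !mxE.
    by have /andP[_ ->] := aP i; have /andP[-> _] := bP i.
  case: asboolP => // -[]; apply: subset_trans xeS => y yab; split=> // i j.
  have := yab j; rewrite /= in_itv/= !mxE (ord1 i) /ball/= => /andP[h1 h2].
  have /andP[? ?] := aP j; have /andP[? ?] := bP j.
  rewrite ltr_norml; lra.
rewrite /measurable_rV preimage_bigcup; apply: countable_bigcupT_measurable.
  exact: countableP.
move=> q; case: ifP => _; last by rewrite preimage_set0.
exact: (@measurable_rV_box (fun i => `]ratr (q.1 ord0 i), ratr (q.2 ord0 i)[%classic)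
  (fun i => measurable_itv _)).
Qed.

Lemma closed_measurable_rV S : closed S -> measurable_rV S.
Proof.
move=> cS; have /measurableC := open_measurable_rV (closed_openC cS).
by rewrite -preimage_setC setCK.
Qed.

Lemma lebesgue_rV_ge0 S : (0 <= lebesgue_rV S)%E.
Proof.
by rewrite /lebesgue_rV; have [mu ->] := iter_lebesgue_measure R d.
Qed.

Lemma le_lebesgue_rV S T : measurable_rV S -> measurable_rV T -> S `<=` T ->
  (lebesgue_rV S <= lebesgue_rV T)%E.
Proof.
rewrite /lebesgue_rV; have [mu ->] := iter_lebesgue_measure R d.
move=> mS mT ST; apply: le_measure; rewrite ?inE// => p; exact: ST.
Qed.

Lemma lebesgue_rV_sigma_subadditive S (F : nat -> set 'rV[R]_d) :
  measurable_rV S -> (forall k, measurable_rV (F k)) ->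
  S `<=` \bigcup_k F k ->
  (lebesgue_rV S <= \sum_(0 <= k <oo) lebesgue_rV (F k))%E.
Proof.
rewrite /lebesgue_rV; have [mu ->] := iter_lebesgue_measure R d.
move=> mS mF SF; apply: measure_sigma_subadditive => //.
by rewrite -preimage_bigcup => p; exact: SF.
Qed.

Lemma lebesgue_rV_subadditive n (F : 'I_n -> set 'rV[R]_d) :
  (forall k, measurable_rV (F k)) ->
  (lebesgue_rV (\bigcup_k F k) <= \sum_(k < n) lebesgue_rV (F k))%E.
Proof.
elim: n F => [F _|n IH F mF].
  rewrite big_ord0 (_ : \bigcup_k _ = set0); last first.
    by apply/seteqP; split => // x [[]].
  rewrite /lebesgue_rV preimage_set0; have [mu ->] := iter_lebesgue_measure R d.
  by rewrite measure0.
rewrite big_ord_recl.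
have mF' := measurable_rV_bigcup_ord (fun k => mF (lift ord0 k)).
apply: le_trans (leeD2l _ (IH _ (fun k => mF (lift ord0 k)))).
have := mF ord0; move: mF'; rewrite /measurable_rV/lebesgue_rV.
have [mu ->] := iter_lebesgue_measure R d => mU m0.
apply: le_trans (measureU2 _ m0 mU); apply: le_measure; rewrite ?inE.
- rewrite preimage_bigcup; apply: fin_bigcup_measurable => [|k _].
    exact: finite_finset.
  exact: mF.
- exact: measurableU.
- move=> p [k _]; case: (unliftP ord0 k) => [j ->|->] h; last by left.
  by right; exists j.
Qed.

Lemma sum_lebesgue_rV_le n (F : 'I_n -> set 'rV[R]_d) T :
  (forall k, measurable_rV (F k)) -> measurable_rV T -> trivIset setT F ->
  (forall k, F k `<=` T) -> (\sum_(k < n) lebesgue_rV (F k) <= lebesgue_rV T)%E.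
Proof.
move=> mF mT tF FT; rewrite /lebesgue_rV.
have [mu ->] := iter_lebesgue_measure R d.
rewrite -(measure_bigsetU_ord mu xpredT
  (F := fun k => row_of_iter (n := d) @^-1` F k))//.
  apply: le_measure; rewrite ?inE//.
    by apply: bigsetU_measurable => k _; exact: mF.
  by elim/big_ind: _ => // [A B AT BT p [/AT|/BT]//|k _ p /FT].
apply/trivIsetP => i j _ _ ij; rewrite -preimage_setI.
by have /trivIsetP/(_ i j Logic.I Logic.I ij) -> := tF; rewrite preimage_set0.
Qed.

(** The closed sup-norm ball, written as a product of intervals so that [lebesgue_rV_box] gives its
    volume. *)
Definition cube p h : set 'rV[R]_d :=
  [set x | forall i, `[p ord0 i - h, p ord0 i + h]%classic (x ord0 i)].

Lemma measurable_rV_cube p h : measurable_rV (cube p h).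
Proof.
exact: (@measurable_rV_box (fun i => `[p ord0 i - h, p ord0 i + h]%classic)
  (fun i => measurable_itv _)).
Qed.

Lemma cubeP p h x : 0 <= h -> cube p h x <-> `|x - p| <= h.
Proof.
move=> h0; split=> [c|xp i].
  rewrite [leLHS]/Num.norm/= mx_normrE; apply/bigmax_leP; split=> // -[i j] _.
  have := c j; rewrite /= in_itv/= (ord1 i) !mxE ler_norml; lra.
have := le_trans (coord_le_norm _ i) xp.
rewrite !mxE /= in_itv/= ler_norml; lra.
Qed.

Lemma lebesgue_rV_cube p h : 0 <= h ->
  lebesgue_rV (cube p h) = ((2 * h) ^+ d)%:E.
Proof.
move=> h0.
have [_] := @lebesgue_rV_box R d (fun i => `[p ord0 i - h, p ord0 i + h]%classic)
  (fun i => measurable_itv _).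
rewrite -/(cube p h) => ->.
under eq_bigr => i _.
  rewrite lebesgue_measure_itv/= lte_fin.
  (* For [h = 0] the interval is a point, and the value 0 agrees with [2 * h]. *)
  have -> : (if (p ord0 i - h < p ord0 i + h)%R
      then (p ord0 i + h)%:E - (p ord0 i - h)%:E else 0)%E = (2 * h)%:E.
    by case: ifPn => ?; rewrite -?EFinB; congr EFin; lra.
  over.
by rewrite prodEFin prodr_const card_ord.
Qed.

End lebesgue_row_vectors.

(** * Separated families in a normed space *)

Section separated.
Context {R : realType} {V : normedModType R}.
Implicit Types (E : set V) (r : R).

Definition separated E r n (x : 'I_n -> V) :=
  (forall i, E (x i)) /\ (forall i j, i != j -> r <= `|x i - x j|).

(** Greedy choice: a family that does not cover extends by an uncovered point. Once a volume bound
    excludes large [n], a family both separated and covering remains. *)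
Lemma separated_cover_or E r n :
  (exists m (x : 'I_m -> V), separated E r x /\ E `<=` \bigcup_i ball (x i) r) \/
  (exists x : 'I_n -> V, separated E r x).
Proof.
elim: n => [|n [IH|[x [xE xr]]]]; [|by left|].
  by right; exists (fun=> 0); split=> [[]|[]].
have [cov|/existsNP[y /not_implyP[Ey ny]]] :=
    pselect (E `<=` \bigcup_i ball (x i) r); first by left; exists n, x.
right; exists (fun i => if unlift ord0 i is Some j then x j else y).
have yx j : r <= `|y - x j|.
  rewrite leNgt; apply: contra_notN ny => yxj; exists j => //.
  by rewrite -ball_normE /= distrC.
split=> [i|i j]; first by case: unliftP.
case: (unliftP ord0 i) => [i' ->|->]; case: (unliftP ord0 j) => [j' ->|->] //.
- by rewrite (inj_eq lift_inj); exact: xr.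
- by move=> _; rewrite distrC.
Qed.

End separated.

(** * Covering numbers bounded by the outer parallel volume *)

Section box_le_minkowski.
Context {R : realType} {d : nat}.
Implicit Types (x y : 'rV[R]_d) (t q s : R) (A : set 'rV[R]_d).

Lemma parallel_set_diff_measurable A t : compact A ->
  measurable_rV (parallel_set A t `\` A).
Proof.
move=> cA; apply: measurable_rVD; apply: closed_measurable_rV.
  exact: parallel_set_closed.
by apply: compact_closed => //; exact: norm_hausdorff.
Qed.

Lemma compact_cube_bound A : compact A ->
  exists2 M, 0 < M & forall a, A a -> `|a| <= M.
Proof.
move=> /compact_bounded; move=> /ex_strict_bound_gt0[M M0 AM].
by exists M => // a /AM /ltW.
Qed.

(** This crude bound limits the size of separated families and later settles exponents above [d]. *)
Lemma parallel_volume_bounded A : A !=set0 -> compact A ->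
  exists2 M, 0 < M & forall t, 0 <= t ->
    (lebesgue_rV (parallel_set A t `\` A) <= ((2 * (M + t)) ^+ d)%:E)%E.
Proof.
move=> A0 cA; have [M M0 AM] := compact_cube_bound cA; exists M => // t t0.
have Mt : 0 <= M + t by rewrite addr_ge0// ltW.
rewrite -(lebesgue_rV_cube 0)//; apply: le_lebesgue_rV.
- exact: parallel_set_diff_measurable.
- exact: measurable_rV_cube.
move=> y [yt _]; apply/cubeP => //; rewrite subr0.
have [x [Ax xy]] := nearest_exists y A0 cA.
rewrite -(subrK x y) addrC; apply: le_trans (ler_normD _ _) _.
by rewrite lerD ?AM//; apply: le_trans (normr_le_enorm _) _; rewrite xy.
Qed.

Lemma separated_volume_le A t m (x : 'I_m -> 'rV[R]_d) : (0 < d)%N ->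
  compact A -> 0 < t -> separated (reach_set A t) (t / (2 * d%:R)) x ->
  ((m%:R * (t / (8 * d%:R ^+ 2)) ^+ d)%:E <=
    lebesgue_rV (parallel_set A t `\` A))%E.
Proof.
move=> d0 cA t0 [xE xs].
have d1 : 1 <= d%:R :> R by rewrite ler1n.
have dN0 : d%:R != 0 :> R by rewrite gt_eqF// (lt_le_trans ltr01).
(* the cube of half-side [h] about [x i + r u i] lies in the ball of radius [r]
   about the same point, hence off [A] and within distance [2 r] of [x i],
   where [4 r] is the separation of the points [x i] *)
set r := t / (8 * d%:R); set h := t / (16 * d%:R ^+ 2).
have r0 : 0 < r by rewrite divr_gt0// mulr_gt0// (lt_le_trans ltr01).
have h0 : 0 < h by rewrite divr_gt0// mulr_gt0// exprn_gt0// (lt_le_trans ltr01).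
have rt : 2 * r <= t.
  rewrite /r mulrA ler_pdivrMr ?mulr_gt0// ?(lt_le_trans ltr01)//; nra.
have hr : d%:R * h = r / 2 by rewrite /h /r; field.
have hr2 : h <= r / 2 by rewrite -hr ler_peMl// ltW.
have rs : t / (2 * d%:R) = 4 * r by rewrite /r; field.
have t0' := ltW t0.
have /choice[u uP] i := reach_set_empty_ball t0' (xE i).
pose F i := cube (x i + r *: u i) h.
have Fx i y : F i y -> enorm (y - (x i + r *: u i)) <= r / 2.
  move/cubeP => /(_ (ltW h0)) yh; apply: le_trans (enorm_le_norm _) _.
  by rewrite -hr ler_wpM2l.
have Fxx i y : F i y -> enorm (y - x i) <= 3 * r / 2.
  move=> /Fx yF; apply: le_trans (ler_enormB _ (x i + r *: u i) _) _.
  rewrite [x i + _ - _]addrC addKr enormZ; have [_ -> _] := uP i.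
  rewrite mulr1 gtr0_norm//; lra.
have -> : (m%:R * (t / (8 * d%:R ^+ 2)) ^+ d)%:E =
    (\sum_(i < m) lebesgue_rV (F i))%E.
  under eq_bigr do rewrite lebesgue_rV_cube ?(ltW h0)//.
  have -> : 2 * h = t / (8 * d%:R ^+ 2) by rewrite /h; field.
  by rewrite sumEFin sumr_const card_ord mulr_natl.
apply: sum_lebesgue_rV_le => //.
- by move=> i; exact: measurable_rV_cube.
- exact: parallel_set_diff_measurable.
(* A common point would put the two centres [x i], [x j] within [3 * r] of each other, below the
   separation [4 * r]. *)
- apply/trivIsetP => i j _ _ /xs; rewrite rs => xij.
  apply/seteqP; split=> // y [/Fxx yi /Fxx yj]; move: xij.
  have := le_trans (normr_le_enorm _) (ler_enormB (x i) y (x j)).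
  rewrite (enormBC (x i)); lra.
- move=> i y yF; have [Ax _ ue] := uP i; split=> [|Ay].
    rewrite /parallel_set/=; apply: le_trans (dist_le _ Ax) _.
    have := Fxx _ _ yF; lra.
  (* The centre of the cube is at least [r] away from [A], but at most [r / 2] from [y]. *)
  have := ue r _ Ay; have := Fx _ _ yF; rewrite (enormBC y) => h1 h2.
  have : 0 <= r <= t by lra.
  move=> /h2; lra.
Qed.

(** One family serves both claims: covering bounds the covering number by its size [m], and
    separation bounds the volume below. *)
Lemma covering_number_volume A t : (0 < d)%N -> A !=set0 -> compact A -> 0 < t ->
  exists m : nat, (covering_number A t <= m%:R%:E)%E /\
  ((m%:R * (t / (8 * d%:R ^+ 2)) ^+ d)%:E <=
    lebesgue_rV (parallel_set A t `\` A))%E.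
Proof.
move=> d0 A0 cA t0.
have d1 : 0 < d%:R :> R by rewrite ltr0n.
have [M M0 /(_ t (ltW t0)) VM] := parallel_volume_bounded A0 cA.
set c := (t / (8 * d%:R ^+ 2)) ^+ d.
have c0 : 0 < c by rewrite exprn_gt0// divr_gt0// mulr_gt0// exprn_gt0.
set K := (2 * (M + t)) ^+ d in VM.
(* So many separated points would need a volume above the bound [K]. *)
pose n := (Num.truncn (K / c)).+1.
have Kn : K < n%:R * c.
  rewrite -ltr_pdivrMr//; apply: truncnS_gt.
have [[m [x [xs cov]]]|[x xs]] :=
    separated_cover_or (reach_set A t) (t / (2 * d%:R)) n; last first.
  have := le_trans (separated_volume_le d0 cA t0 xs) VM.
  by rewrite lee_fin leNgt Kn.
exists m; split; last exact: separated_volume_le xs.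
apply: ereal_inf_lbound; exists m => //.
exists (fun i => ball (x i) (t / (2 * d%:R))); split=> // i; split.
  by apply: ball_open; rewrite divr_gt0// mulr_gt0.
apply: ub_ereal_sup => _ [[y z] [/= yi zi] <-]; rewrite lee_fin.
(* Passing to the Euclidean norm costs a factor [d]; the sup radius [t / (2 * d)] absorbs it, so the
   diameter is at most [t]. *)
apply: le_trans (enorm_le_norm _) _.
have -> : t = d%:R * (t / (2 * d%:R) + t / (2 * d%:R)) by field; rewrite gt_eqF.
rewrite ler_pM2l//; move: yi zi; rewrite -ball_normE/= => yi zi.
apply: le_trans (ler_distD (x i) _ _) _; rewrite distrC ltW// ltrD//.
Qed.

Lemma lne_le_ln (x : \bar R) (y : R) : 0 < y -> (x <= y%:E)%E ->
  (lne x <= (ln y)%:E)%E.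
Proof.
move: x => [x| |]//= y0 xy; last exact: leNye.
(* [lne] is minus infinity at nonpositive reals. *)
by have [x0|x0] := leP x 0; [exact: leNye|rewrite lee_fin ler_ln].
Qed.

Lemma ln_le_lne (x : \bar R) (y : R) : 0 < y -> (y%:E <= x)%E ->
  ((ln y)%:E <= lne x)%E.
Proof.
move: x => [x| |]//= y0; last by rewrite !leey.
rewrite lee_fin => xy; have x0 := lt_le_trans y0 xy.
by rewrite (lt_geF x0) lee_fin ler_ln.
Qed.

Lemma box_quotientE A t : 0 < t < 1 ->
  box_quotient A t = (lne (covering_number A t) * ((- ln t)^-1)%:E)%E.
Proof.
move=> /andP[t0 t1]; rewrite /box_quotient inver gt_eqF//.
by rewrite oppr_gt0 ln_lt0// t0.
Qed.

Lemma box_quotient_le A t q : 0 < t < 1 ->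
  (covering_number A t <= (t `^ (- q))%:E)%E -> (box_quotient A t <= q%:E)%E.
Proof.
move=> t01; have /andP[t0 t1] := t01.
have lt0 : 0 < - ln t by rewrite oppr_gt0 ln_lt0.
move=> /lne_le_ln; rewrite powR_gt0// ln_powR => /(_ isT) h.
by rewrite box_quotientE// lee_pdivrMr// -EFinM mulrN -mulNr.
Qed.

Lemma box_quotient_ge A t q : 0 < t < 1 ->
  ((t `^ (- q))%:E <= covering_number A t)%E -> (q%:E <= box_quotient A t)%E.
Proof.
move=> t01; have /andP[t0 t1] := t01.
have lt0 : 0 < - ln t by rewrite oppr_gt0 ln_lt0.
move=> /ln_le_lne; rewrite powR_gt0// ln_powR => /(_ isT) h.
by rewrite box_quotientE// lee_pdivlMr// -EFinM mulrN -mulNr.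
Qed.

(** With [m] from [covering_number_volume] and [c = k ^+ d], the hypothesis reads
    [m * t ^ q * c < c], so [m < t ^ (- q)]. Being pointwise in [t] with a uniform [c], the
    implication passes to upper and lower limits alike. *)
Lemma minkowski_box_quotient : (0 < d)%N -> exists2 c : R, 0 < c &
  forall A t q, A !=set0 -> compact A -> 0 < t < 1 ->
  (out_minkowski_quotient A q t < c%:E)%E -> (box_quotient A t <= q%:E)%E.
Proof.
move=> d0; have d1 : 0 < d%:R :> R by rewrite ltr0n.
set k := (8 * d%:R ^+ 2)^-1 : R.
have k0 : 0 < k by rewrite invr_gt0 mulr_gt0// exprn_gt0.
exists (k ^+ d) => [|A t q A0 cA t01 qc]; first exact: exprn_gt0.
have /andP[t0 t1] := t01.
have [m [cm mV]] := covering_number_volume d0 A0 cA t0.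
apply: box_quotient_le => //; apply: le_trans cm _; rewrite lee_fin.
have P : 0 < t `^ (q - d%:R) by rewrite powR_gt0.
have : ((t `^ (q - d%:R))%:E * (m%:R * (t * k) ^+ d)%:E < (k ^+ d)%:E)%E.
  by apply: le_lt_trans qc; rewrite lee_pmul2l.
rewrite -EFinM lte_fin exprMn -(powR_mulrn d (ltW t0)).
have -> : t `^ (q - d%:R) * (m%:R * (t `^ d%:R * k ^+ d)) =
    (m%:R * t `^ q) * k ^+ d.
  rewrite powRB; first by field; rewrite gt_eqF// powR_gt0.
  by rewrite (gt_eqF t0) implybT.
rewrite -[ltRHS]mul1r ltr_pM2r ?exprn_gt0// powRN => /ltW.
by rewrite -[t `^ q in X in _ -> X]invrK -ler_pdivlMr ?powR_gt0// div1r invrK.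
Qed.

End box_le_minkowski.

(** * Outer parallel volume bounded by covering numbers *)

Section minkowski_le_box.
Context {R : realType} {d : nat}.
Implicit Types (x y : 'rV[R]_d) (t q s : R) (A : set 'rV[R]_d).

Lemma ediam_le (U : set 'rV[R]_d) t x y :
  (ediam U <= t%:E)%E -> U x -> U y -> enorm (x - y) <= t.
Proof.
move=> Ut Ux Uy; rewrite -lee_fin; apply: le_trans Ut.
by apply: ereal_sup_ubound; exists (x, y).
Qed.

(** The strict bound by a real [K] yields an actual cover by fewer than [K] sets, even if the
    infimum were not attained. *)
Lemma shell_cover A t (K : R) : A !=set0 -> compact A -> 0 < t ->
  (covering_number A t < K%:E)%E ->
  exists B : set 'rV[R]_d, [/\ measurable_rV B,
    [set y | t < dist y A <= 2 * t] `<=` B &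
    (lebesgue_rV B <= (K * (6 * t) ^+ d)%:E)%E].
Proof.
move=> A0 cA t0 /ereal_inf_lt[_ [n [U [oU cov]] <-]]; rewrite lte_fin => nK.
(* Each nonempty [U i] gets a point of its own as cube centre; an empty one gets 0. *)
have /choice[p pU] i : exists p, forall x, U i x -> U i p.
  have [[p Up]|nU] := pselect (exists p, U i p); first by exists p.
  by exists 0 => x Ux; case: nU; exists x.
exists (\bigcup_i cube (p i) (3 * t)); split.
- by apply: measurable_rV_bigcup_ord => i; exact: measurable_rV_cube.
- move=> y /= /andP[ty yt]; have [x nyx] := nearest_exists y A0 cA.
  have : reach_set A t x by apply: nearest_reach_set nyx _; rewrite (ltW t0).
  (* The half-side [3 * t] is [2 * t] from [y] to [x] plus the diameter [t] of [U i]. *)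
  move=> /cov[i _ Ux]; exists i => //; apply/cubeP; first by lra.
  apply: le_trans (normr_le_enorm _) _; apply: le_trans (ler_enormB _ x _) _.
  have [_ yx] := nyx; have [_ Ut] := oU i.
  have := ediam_le Ut Ux (pU i _ Ux); rewrite yx; lra.
- apply: le_trans (lebesgue_rV_subadditive _) _.
    by move=> i; exact: measurable_rV_cube.
  under eq_bigr do rewrite lebesgue_rV_cube ?mulr_ge0 ?(ltW t0)//.
  have -> : 2 * (3 * t) = 6 * t by ring.
  rewrite sumEFin sumr_const card_ord lee_fin -[leLHS]mulr_natl.
  by rewrite ler_wpM2r ?exprn_ge0 ?mulr_ge0 ?(ltW t0)// ltW.
Qed.

Lemma powR_exprn (a b : R) n : 0 <= b -> (b ^+ n) `^ a = (b `^ a) ^+ n.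
Proof.
by move=> b0; rewrite -!powR_mulrn ?powR_ge0// -!powRrM mulrC.
Qed.

(** The shell at scale [t] has volume at most [6 ^ d * t ^ (d - s)]. Over dyadic scales this is
    geometric of ratio [z = 2 ^ (s - d)], below 1 because [s < d]. *)
Lemma parallel_volume_le A s (e0 : R) : A !=set0 -> compact A -> s < d%:R ->
  0 < e0 -> (forall t, 0 < t < e0 -> (covering_number A t < (t `^ (- s))%:E)%E) ->
  exists2 C, 0 <= C & forall e, 0 < e < e0 ->
    (lebesgue_rV (parallel_set A e `\` A) <= (C * e `^ (d%:R - s))%:E)%E.
Proof.
move=> A0 cA sd e00 cov.
set a := d%:R - s; have a0 : 0 < a by rewrite subr_gt0.
set z : R := 2^-1 `^ a.
have z0 : 0 < z by rewrite powR_gt0.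
have z1 : z < 1.
  rewrite /z; have := @gt0_ltr_powR R a a0 2^-1 1.
  by rewrite !nnegrE powR1; apply => //; rewrite invf_lt1// ltr1n.
exists (6 ^+ d * (1 - z)^-1) => [|e /andP[ep ee0]].
  by rewrite mulr_ge0// invr_ge0 subr_ge0 ltW.
(* The exponent [k.+1] makes [k = 0] the outermost shell, from [e / 2] to [e]. *)
pose t k : R := e * 2^-1 ^+ k.+1.
have t0 k : 0 < t k by rewrite mulr_gt0.
have te k : t k < e0.
  apply: le_lt_trans ee0; rewrite ger_pMr// exprn_ile1//.
  by rewrite invf_le1// ler1n.
have /choice[B BP] k := shell_cover A0 cA (t0 k)
  (cov (t k) (introT andP (conj (t0 k) (te k)))).
have vol k : (lebesgue_rV (B k) <= (6 ^+ d * e `^ a * z ^+ k)%:E)%E.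
  have [_ _ /le_trans] := BP k; apply; rewrite lee_fin.
  rewrite exprMn mulrCA -(powR_mulrn d (ltW (t0 k))) -powRD; last first.
    by rewrite (gt_eqF (t0 k)) implybT.
  rewrite -mulrA addrC -/a ler_pM2l ?exprn_gt0//.
  rewrite powRM ?exprn_ge0 ?(ltW ep)// powR_exprn// -/z ler_pM2l ?powR_gt0//.
  (* The exact power is [z ^+ k.+1]; one factor [z < 1] is dropped. *)
  by rewrite exprS ger_pMl ?exprn_gt0// ltW.
have mB k : measurable_rV (B k) by have [] := BP k.
have sub : parallel_set A e `\` A `<=` \bigcup_k B k.
  move=> y [ye /(dist_gt0 A0 cA) yA].
  have ex : exists k, t k < dist y A.
    have : geometric e (2^-1 : R) @ \oo --> (0 : R).
      by apply: cvg_geometric; rewrite ger0_norm// invf_lt1// ltr1n.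
    move=> /cvgr0_norm_lt/(_ _ yA)[n _ /(_ n.+1 (leqnSn n))] h.
    by exists n; apply: le_lt_trans h; exact: ler_norm.
  (* The least [k] with [t k < dist y A] names the shell of [y]: its outer bound [2 * t k] is [e] if
     [k = 0], and otherwise the preceding [t], where minimality applies. *)
  case: (ex_minnP ex) => k tk kmin.
  exists k => //; have [_ + _] := BP k; apply; rewrite /= tk /=.
  have -> : 2 * t k = e * 2^-1 ^+ k by rewrite /t exprS; field.
  case: k tk kmin => [|k] _ kmin; first by rewrite mulr1.
  by rewrite leNgt; apply/negP => /kmin; rewrite ltnn.
apply: le_trans (lebesgue_rV_sigma_subadditive _ mB sub) _.
  exact: parallel_set_diff_measurable.
apply: lime_le.
  by apply: is_cvg_nneseries => k _ _; exact: lebesgue_rV_ge0.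
apply: nearW => n; apply: le_trans (lee_sum _ (fun k _ => vol k)) _.
rewrite sumEFin lee_fin.
have := @geometric_le_lim R n (6 ^+ d * e `^ a) z.
rewrite mulr_ge0 ?powR_ge0// ger0_norm ?(ltW z0)// => /(_ isT z0 z1).
by rewrite [leRHS]mulrAC.
Qed.

(** * Upper limits at 0 from the right, and the upper Minkowski dimension *)

Lemma right_nbhs_interval (e : R) : 0 < e -> 0^'+ [set t : R | 0 < t < e].
Proof.
move=> e0; exists e => // t /=; rewrite sub0r normrN => te t0.
by rewrite t0 (le_lt_trans (ler_norm t)).
Qed.

Lemma right_nbhsP (S : set R) : 0^'+ S ->
  exists2 e : R, 0 < e & forall t, 0 < t < e -> S t.
Proof.
move=> [e /= e0 eS]; exists e => // t /andP[t0 te]; apply: eS => //=.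
by rewrite sub0r normrN gtr0_norm.
Qed.

Lemma limf_esup_right_le (f : R -> \bar R) (e : R) z : 0 < e ->
  (forall t, 0 < t < e -> (f t <= z)%E) -> (limf_esup f (0 : R)^'+ <= z)%E.
Proof.
move=> e0 fz; apply: (@le_trans _ _ (ereal_sup (f @` [set t | 0 < t < e]))).
  by apply: ereal_inf_lbound; exists [set t | 0 < t < e] => //;
    exact: right_nbhs_interval.
by apply: ub_ereal_sup => _ [t te <-]; exact: fz.
Qed.

Lemma limf_esup_right_lt (f : R -> \bar R) z : (limf_esup f (0 : R)^'+ < z)%E ->
  exists2 e : R, 0 < e & forall t, 0 < t < e -> (f t < z)%E.
Proof.
move=> /ereal_inf_lt[_ [S /right_nbhsP[e e0 eS] <-] Sz]; exists e => // t te.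
by apply: le_lt_trans Sz; apply: ereal_sup_ubound; exists t => //; exact: eS.
Qed.

Lemma upper_content_eq0 A q b (C e0 : R) : 0 <= C -> 0 < e0 ->
  0 < q - d%:R + b ->
  (forall e, 0 < e < e0 ->
    (lebesgue_rV (parallel_set A e `\` A) <= (C * e `^ b)%:E)%E) ->
  upper_out_minkowski_content A q = 0%E.
Proof.
move=> C0 e00; set a := q - d%:R + b => a0 vol.
apply/eqP; rewrite eq_le; apply/andP; split; last first.
  apply: limf_esup_ge0 => [|e]; first exact: (@filter_not_empty _ 0^'+).
  by rewrite mule_ge0 ?lee_fin ?powR_ge0// lebesgue_rV_ge0.
apply/lee_addgt0Pr => h h0; rewrite add0e.
have C1 : 0 < C + 1 by rewrite ltr_wpDl.
(* Chosen so that [e1 ^ a = h / (C + 1)], whence [C * e ^ a <= h] below [e1]; [C + 1] is positive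
   even if [C = 0]. *)
set e1 := (h / (C + 1)) `^ a^-1.
have e10 : 0 < e1 by rewrite powR_gt0// divr_gt0.
pose em := Num.min e0 e1.
have em0 : 0 < em by rewrite lt_min e00.
apply: (limf_esup_right_le em0) => e /andP[ep].
rewrite lt_min => /andP[ee0 ee1].
apply: (@le_trans _ _ ((e `^ (q - d%:R))%:E * (C * e `^ b)%:E)%E).
  by rewrite lee_wpmul2l ?lee_fin ?powR_ge0// vol// ep.
rewrite -EFinM lee_fin mulrCA -powRD; last by rewrite (gt_eqF ep) implybT.
rewrite -/a.
have : e `^ a <= h / (C + 1).
  have -> : h / (C + 1) = e1 `^ a.
    by rewrite -powRrM mulVf ?gt_eqF// powRr1// ltW// divr_gt0.
  by apply: ge0_ler_powR; rewrite ?nnegrE ltW.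
rewrite ler_pdivlMr// => h1; have := powR_ge0 e a; nra.
Qed.

Lemma row_notin_compact A : (0 < d)%N -> compact A -> exists y, ~ A y.
Proof.
move=> d0 /compact_cube_bound[M M0 AM]; exists (const_mx (M + 1)) => /AM.
have := coord_le_norm (const_mx (M + 1) : 'rV[R]_d) (Ordinal d0).
rewrite mxE ger0_norm; lra.
Qed.

Lemma covering_number_ge1 A t x : reach_set A t x -> (1 <= covering_number A t)%E.
Proof.
move=> tx; apply: le_ereal_inf_tmp => _ [[|n] [U [_ cov]] <-].
  by have [[]] := cov _ tx.
by rewrite lee_fin ler1n.
Qed.

(** A point off [A] makes [reach_set A t] nonempty for all small [t], so covering numbers are at
    least 1. This matters because Minkowski exponents range over [q >= 0] only. *)
Lemma upper_out_box_dim_ge0 A : (0 < d)%N -> A !=set0 -> compact A ->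
  (0 <= upper_out_box_dim A)%E.
Proof.
move=> d0 A0 cA; apply: le_ereal_inf_tmp => _ [S S0 <-].
have [y Ay] := row_notin_compact d0 cA.
have r0 := dist_gt0 A0 cA Ay; have [x nyx] := nearest_exists y A0 cA.
have [e e0 eS] := right_nbhsP S0.
pose m := Num.min e (Num.min 1 (dist y A)).
have m0 : 0 < m by rewrite !lt_min e0 ltr01.
have [me m1 mr] : [/\ m <= e, m <= 1 & m <= dist y A].
  by rewrite !ge_min !lexx !orbT.
have /eS St : 0 < m / 2 < e by lra.
apply: le_trans (ereal_sup_ubound _); last first.
  by exists (m / 2); [exact: St|reflexivity].
apply: box_quotient_ge; first lra.
rewrite oppr0 powRr0; apply: (@covering_number_ge1 _ _ x).
by apply: nearest_reach_set nyx _; lra.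
Qed.

Lemma upper_minkowski_le_box A : (0 < d)%N -> A !=set0 -> compact A ->
  (upper_out_minkowski_dim A <= upper_out_box_dim A)%E.
Proof.
move=> d0 A0 cA; have := upper_out_box_dim_ge0 d0 A0 cA.
case E : (upper_out_box_dim A) => [L| |]; last 2 first.
- by move=> _; exact: leey.
- by rewrite leeNy_eq.
rewrite lee_fin => L0; apply/lee_addgt0Pr => h h0.
apply: ereal_inf_lbound; exists (L + h) => //; split.
  by rewrite addr_ge0// ltW.
(* Above [d], boundedness of the volume suffices ([b = 0]); up to [d], the geometric series
   applies. *)
have [qd|dq] := leP (L + h) d%:R; last first.
  have [M M0 VM] := parallel_volume_bounded A0 cA.
  apply: (@upper_content_eq0 _ _ 0 ((2 * (M + 1)) ^+ d) 1) => //.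
  - by rewrite exprn_ge0// mulr_ge0// addr_ge0// ltW.
  - lra.
  move=> e /andP[e0 e1]; rewrite powRr0 mulr1.
  apply: le_trans (VM _ (ltW e0)) _; rewrite lee_fin lerXn2r ?nnegrE//; lra.
(* The intermediate exponent [L + h / 2] is below [d] and leaves a surplus [h / 2] for the content
   at [L + h] to vanish. *)
have : (upper_out_box_dim A < (L + h / 2)%:E)%E by rewrite E lte_fin; lra.
move=> /limf_esup_right_lt[e e0 eS].
have em0 : 0 < Num.min e 1 by rewrite lt_min e0 ltr01.
have [|t t01|C C0 vol] :=
  @parallel_volume_le A (L + h / 2) (Num.min e 1) A0 cA _ em0.
- lra.
- have /andP[t0] := t01; rewrite lt_min => /andP[te t1].
  rewrite ltNge; apply/negP => /box_quotient_ge; rewrite t0 t1 => /(_ isT).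
  by rewrite leNgt eS// t0.
- by apply: upper_content_eq0 C0 em0 _ vol; lra.
Qed.

End minkowski_le_box.

(** * Outer box dimensions bounded by outer Minkowski dimensions *)

Section box_le_minkowski_dim.
Context {R : realType} {d : nat}.
Implicit Types (A : set 'rV[R]_d).

Lemma upper_box_le_minkowski A : (0 < d)%N -> A !=set0 -> compact A ->
  (upper_out_box_dim A <= upper_out_minkowski_dim A)%E.
Proof.
move=> d0 A0 cA; have [c c0 cP] := @minkowski_box_quotient R d d0.
apply: le_ereal_inf_tmp => _ [q [q0 q1] <-].
have : (upper_out_minkowski_content A q < c%:E)%E by rewrite q1 lte_fin.
move=> /limf_esup_right_lt[e e0 eS].
have em0 : 0 < Num.min e 1 by rewrite lt_min e0 ltr01.
apply: (limf_esup_right_le em0) => t /andP[t0]; rewrite lt_min => /andP[te t1].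
by apply: cP; rewrite ?t0// eS// t0.
Qed.

(** A vanishing lower content gives arbitrarily small [t] with quotient below [c], enough to bound a
    lower limit. The shell argument, in contrast, uses covers at all smaller scales, which a lower
    limit does not control. *)
Lemma lower_box_le_minkowski A : (0 < d)%N -> A !=set0 -> compact A ->
  (lower_out_box_dim A <= lower_out_minkowski_dim A)%E.
Proof.
move=> d0 A0 cA; have [c c0 cP] := @minkowski_box_quotient R d d0.
apply: le_ereal_inf_tmp => _ [q [q0 +] <-].
rewrite /lower_out_minkowski_content /lower_out_box_dim !limf_einfE => q1.
apply: ub_ereal_sup => _ [S /right_nbhsP[e e0 eS] <-].
have em0 : 0 < Num.min e 1 by rewrite lt_min e0 ltr01.
pose I := [set t : R | 0 < t < Num.min e 1].
have : (ereal_inf (out_minkowski_quotient A q @` I) < c%:E)%E.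
  apply: (@le_lt_trans _ _ 0%E); last by rewrite lte_fin.
  by rewrite -q1; apply: ereal_sup_ubound; exists I => //;
    exact: right_nbhs_interval.
move=> /ereal_inf_lt[v [t /= /andP[t0]]]; rewrite lt_min => /andP[te t1] <- tc.
apply: (@le_trans _ _ (box_quotient A t)); last by apply: cP tc; rewrite ?t0.
by apply: ereal_inf_lbound; exists t => //; apply: eS; rewrite t0.
Qed.

End box_le_minkowski_dim.

Unset Implicit Arguments.

Theorem proposition4p6 (R : realType) (d : nat) (hd : (2 <= d)%N)
  (A : set 'rV[R]_d) (A_nonempty : A !=set0) (A_compact : compact A) :
  upper_out_box_dim A = upper_out_minkowski_dim A /\
  (lower_out_box_dim A <= lower_out_minkowski_dim A)%E.
Proof.
have d0 : (0 < d)%N := ltnW hd.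
split; last exact: lower_box_le_minkowski.
by apply/eqP; rewrite eq_le upper_box_le_minkowski// upper_minkowski_le_box//.
Qed.
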